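(* For complex $q$ with $|q|<1$, $f_1(q)=f_3(q)$, where $$f_1(q):=\sum_{k\geq1} \left(\frac{k(k-1)q^k}{1-q^k}-\frac{2kq^{2k}}{(1-q^k)^2}\right),\qquad f_3(q):=\sum_{k\geq1}\sum_{\ell>k}\frac{2k\,q^{k+\ell}}{(1-q^k)(1-q^{\ell})}.$$ *)

(* Defs.v *)
From Stdlib Require Import Reals.
From Coquelicot Require Import Coquelicot.

Open Scope C_scope.

(* Sums over all n >= m.  [csum_from] is total (like Coquelicot's real [Series],
   which has no complex counterpart) and is meaningful only under
   [ex_csum_from]; see [csum_from_unique]. *)
Definition is_csum_from (m : nat) (a : nat -> C) (s : C) : Prop :=
  is_series (V := C_NormedModule) (fun n : nat => a (m + n)%nat) s.

Definition ex_csum_from (m : nat) (a : nat -> C) : Prop :=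
  exists s : C, is_csum_from m a s.

Definition csum_from (m : nat) (a : nat -> C) : C :=
  iota (T := C_CompleteNormedModule) (is_csum_from m a).

Lemma csum_from_unique (m : nat) (a : nat -> C) (s : C) :
  is_csum_from m a s -> csum_from m a = s.
Proof.
intros Hs.
exact (iota_filterlim_locally (V := C_CompleteNormedModule) _ s Hs).
Qed.

Definition natC (n : nat) : C := RtoC (INR n).

Definition f1_term (q : C) (k : nat) : C :=
  natC k * (natC k - 1) * q ^ k / (1 - q ^ k)
  - 2 * natC k * q ^ (2 * k) / (1 - q ^ k) ^ 2.

Definition f1 (q : C) : C := csum_from 1 (f1_term q).

Definition f3_term (q : C) (k l : nat) : C :=
  2 * natC k * q ^ (k + l) / ((1 - q ^ k) * (1 - q ^ l)).

Definition f3_inner (q : C) (k : nat) : C := csum_from (S k) (f3_term q k).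

Definition f3 (q : C) : C := csum_from 1 (f3_inner q).

(* Main.v *)
Require Import Defs.
From Stdlib Require Import Reals Lra Lia.
From Coquelicot Require Import Coquelicot.

Open Scope C_scope.

(** Put [x k = q^k / (1 - q^k)], so that [x a * x b = x (a+b) * (1 + x a + x b)].
    Summing this with weight [a + b] over [a + b <= N] gives the exact identity
    [sum_{n<=N} (n (n-1) x n - 2 n (x n)^2) = sum_{a<=N} 2 a x a (S (N-a) - S a)],
    where [S m = x 1 + ... + x m].  The left side is a partial sum of [f1];
    replacing [S (N-a)] by the full sum [T] of the [x k] turns the right side
    into a partial sum of [f3], at a cost of
    [sum_{a<=N} 2 a |x a| |T - S (N-a)| = O(N^2 |q|^N)]. *)

(** * Finite sums over the indices 1 to n *)

Fixpoint csum (u : nat -> C) (n : nat) : C :=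
  match n with
  | O => 0
  | S m => csum u m + u (S m)
  end.

Lemma natC_S (n : nat) : natC (S n) = natC n + 1.
Proof. unfold natC. rewrite S_INR, RtoC_plus. reflexivity. Qed.

Lemma natC_add (m n : nat) : natC (m + n) = natC m + natC n.
Proof. unfold natC. rewrite plus_INR, RtoC_plus. reflexivity. Qed.

Lemma Cmod_natC (n : nat) : Cmod (natC n) = INR n.
Proof. unfold natC. rewrite Cmod_R, Rabs_pos_eq; auto using pos_INR. Qed.

Lemma csum_ext (u v : nat -> C) (n : nat) :
  (forall a, (1 <= a <= n)%nat -> u a = v a) -> csum u n = csum v n.
Proof.
  induction n as [|n IH]; intros H; simpl; [reflexivity|].
  rewrite IH, (H (S n)); [reflexivity | lia |].
  intros a Ha; apply H; lia.
Qed.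

Lemma csum_plus (u v : nat -> C) (n : nat) :
  csum (fun a => u a + v a) n = csum u n + csum v n.
Proof. induction n as [|n IH]; simpl; [|rewrite IH]; ring. Qed.

Lemma csum_scal (c : C) (u : nat -> C) (n : nat) :
  csum (fun a => c * u a) n = c * csum u n.
Proof. induction n as [|n IH]; simpl; [|rewrite IH]; ring. Qed.

Lemma csum_one (n : nat) : csum (fun _ => 1) n = natC n.
Proof. induction n as [|n IH]; simpl; [|rewrite IH, natC_S]; reflexivity. Qed.

Lemma csum_S_first (u : nat -> C) (n : nat) :
  csum u (S n) = u 1%nat + csum (fun a => u (S a)) n.
Proof.
  induction n as [|n IH]; [simpl; ring|].
  change (csum u (S (S n))) with (csum u (S n) + u (S (S n))).
  rewrite IH; simpl; ring.
Qed.

Lemma csum_rev (u : nat -> C) (n : nat) :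
  csum (fun a => u (S n - a)%nat) n = csum u n.
Proof.
  induction n as [|n IH]; [reflexivity|].
  rewrite csum_S_first.
  change (u (S n) + csum (fun a => u (S n - a)%nat) n = csum u n + u (S n)).
  rewrite IH; ring.
Qed.

(** * The exact identity between finite sums *)

(** The reflection a -> N+1-a turns the weight 2a into a + (N+1-a) = N+1, a constant. The hypothesis
    then extracts [x (S N)] and leaves the sum of 1 + x a + x (N+1-a), which is N plus two copies of
    [csum x N]. *)
Lemma convolution_identity (x : nat -> C) (N : nat) :
  (forall a b, (1 <= a)%nat -> (1 <= b)%nat ->
     x a * x b = x (a + b)%nat * (1 + x a + x b)) ->
  csum (fun a => 2 * natC a * x a * x (S N - a)%nat) N
  = natC (S N) * x (S N) * (natC N + 2 * csum x N).
Proof.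
  intros Hx.
  assert (Hsym : csum (fun a => natC a * x a * x (S N - a)%nat) N
               = csum (fun a => natC (S N - a) * x a * x (S N - a)%nat) N).
  { rewrite <- csum_rev. apply csum_ext; intros a Ha.
    replace (S N - (S N - a))%nat with a by lia. ring. }
  transitivity (csum (fun a => natC a * x a * x (S N - a)%nat) N
              + csum (fun a => natC a * x a * x (S N - a)%nat) N).
  { rewrite <- csum_plus. apply csum_ext; intros a _. ring. }
  (* Only one of the two copies is reflected, so that the weights add up to N+1. *)
  rewrite Hsym at 2.
  rewrite <- csum_plus, <- (csum_one N).
  replace (2 * csum x N) with (csum x N + csum (fun a => x (S N - a)%nat) N)
    by (rewrite csum_rev; ring).
  rewrite <- !csum_plus, <- csum_scal.
  apply csum_ext; intros a Ha.
  replace (natC (S N)) with (natC a + natC (S N - a))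
    by (rewrite <- natC_add; f_equal; lia).
  transitivity ((natC a + natC (S N - a)) * (x a * x (S N - a)%nat)); [ring|].
  rewrite Hx by lia.
  replace (a + (S N - a))%nat with (S N) by lia. ring.
Qed.

(** Going from N to N+1 on the right adds the convolution above and the new summand a = N+1. The
    contributions 2 (N+1) x(N+1) [csum x N] cancel, and what remains is the summand n = N+1 of the
    left side. *)
Lemma truncated_identity (x : nat -> C) (N : nat) :
  (forall a b, (1 <= a)%nat -> (1 <= b)%nat ->
     x a * x b = x (a + b)%nat * (1 + x a + x b)) ->
  csum (fun n => natC n * (natC n - 1) * x n - 2 * natC n * (x n * x n)) N
  = csum (fun a => 2 * natC a * x a * (csum x (N - a) - csum x a)) N.
Proof.
  intros Hx. induction N as [|N IH]; [reflexivity|].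
  cbn [csum]. rewrite IH.
  replace (csum (fun a => 2 * natC a * x a * (csum x (S N - a) - csum x a)) N)
    with (csum (fun a => 2 * natC a * x a * (csum x (N - a) - csum x a)) N
          + csum (fun a => 2 * natC a * x a * x (S N - a)%nat) N).
  2: { rewrite <- csum_plus. apply csum_ext; intros a Ha.
       replace (S N - a)%nat with (S (N - a)) by lia. simpl; ring. }
  rewrite convolution_identity by assumption.
  (* In the summand a = N+1 the first inner sum is empty, leaving only - [csum x (S N)]. *)
  rewrite Nat.sub_diag. cbn [csum]. rewrite natC_S. ring.
Qed.

(** * Modulus bounds, convergence and geometric tails *)

Lemma Cmod_csum_le (u : nat -> C) (B : R) (N : nat) :
  (forall a, (1 <= a <= N)%nat -> (Cmod (u a) <= B)%R) ->
  (Cmod (csum u N) <= INR N * B)%R.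
Proof.
  induction N as [|N IH]; intros H.
  - simpl. rewrite Cmod_0. lra.
  - rewrite S_INR. cbn [csum].
    eapply Rle_trans; [apply Cmod_triangle|].
    assert (Cmod (csum u N) <= INR N * B)%R by (apply IH; intros; apply H; lia).
    assert (Cmod (u (S N)) <= B)%R by (apply H; lia). lra.
Qed.

(** The right side is the exact geometric sum multiplied by 1 - s; keeping its negative term is what
    lets the induction on n close. *)
Lemma Cmod_csum_geom (u : nat -> C) (K s : R) (m n : nat) :
  (forall a, (1 <= a)%nat -> (Cmod (u a) <= K * s ^ a)%R) -> (0 <= s < 1)%R ->
  (Cmod (csum u (n + m) - csum u m) * (1 - s) <= K * (s ^ S m - s ^ S (n + m)))%R.
Proof.
  intros H Hs. induction n as [|n IH].
  - simpl. replace (csum u m - csum u m) with (RtoC 0) by ring.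
    rewrite Cmod_0. lra.
  - cbn [csum Nat.add].
    replace (csum u (n + m) + u (S (n + m)) - csum u m)
      with ((csum u (n + m) - csum u m) + u (S (n + m))) by ring.
    eapply Rle_trans.
    { apply Rmult_le_compat_r; [lra | apply Cmod_triangle]. }
    assert (Hu := H (S (n + m)) ltac:(lia)).
    apply (Rmult_le_compat_r (1 - s)) in Hu; [|lra].
    change (s ^ S (S (n + m)))%R with (s * s ^ S (n + m))%R. lra.
Qed.

Lemma sum_n_csum (m : nat) (a : nat -> C) (n : nat) :
  sum_n (G := C_NormedModule) (fun i => a (S m + i)%nat) n
  = csum a (n + S m) - csum a m.
Proof.
  induction n as [|n IH].
  - rewrite sum_O, Nat.add_0_r.
    change (a (S m) = csum a m + a (S m) - csum a m). ring.
  - rewrite sum_Sn, IH. replace (S m + S n)%nat with (S (n + S m)) by lia.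
    change (csum a (n + S m) - csum a m + a (S (n + S m))
            = csum a (n + S m) + a (S (n + S m)) - csum a m). ring.
Qed.

(** Reduces complex convergence to a real sequence tending to 0, where squeezing is available.
    Adding the initial segment [csum a m] to the sum allows all series to be handled through partial
    sums starting at 1. *)
Lemma is_csum_from_Cmod (m : nat) (a : nat -> C) (s : C) :
  is_csum_from (S m) a s <->
  is_lim_seq (fun N => Cmod (csum a N - (csum a m + s))) 0.
Proof.
  rewrite (is_lim_seq_incr_n _ (S m)).
  unfold is_csum_from, is_series.
  rewrite (filterlim_locally_ball_norm (U := C_NormedModule)).
  rewrite <- is_lim_seq_spec. unfold is_lim_seq'.
  unfold ball_norm.
  assert (E : forall n, Cmod (csum a (n + S m) - (csum a m + s))
     = norm (V := C_NormedModule)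
        (minus (sum_n (G := C_NormedModule) (fun i => a (S m + i)%nat) n) s)).
  { intros n. rewrite sum_n_csum.
    change (Cmod (csum a (n + S m) - (csum a m + s))
            = Cmod (csum a (n + S m) - csum a m - s)). f_equal. ring. }
  split; intros H eps; generalize (H eps); apply filter_imp; intros n;
    rewrite E, Rminus_0_r, Rabs_pos_eq by apply norm_ge_0; auto.
Qed.

Lemma is_csum_from_1_Cmod (a : nat -> C) (s : C) :
  is_csum_from 1 a s <-> is_lim_seq (fun N => Cmod (csum a N - s)) 0.
Proof.
  rewrite is_csum_from_Cmod.
  split; apply is_lim_seq_ext; intros n; f_equal; simpl; ring.
Qed.

Lemma is_lim_seq_0_le (u v : nat -> R) :
  (forall n, 0 <= u n <= v n)%R -> is_lim_seq v 0 -> is_lim_seq u 0.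
Proof.
  intros H Hv. apply (is_lim_seq_le_le (fun _ => 0%R) u v); auto.
  apply is_lim_seq_const.
Qed.

Lemma is_lim_seq_geom_scal (K s : R) :
  (0 <= s < 1)%R -> is_lim_seq (fun n => K * s ^ n)%R 0.
Proof.
  intros Hs. replace (Finite 0) with (Rbar_mult K 0) by (simpl; f_equal; ring).
  apply is_lim_seq_scal_l, is_lim_seq_geom. rewrite Rabs_pos_eq; lra.
Qed.

Lemma ex_csum_geom (u : nat -> C) (K s : R) :
  (forall a, (1 <= a)%nat -> (Cmod (u a) <= K * s ^ a)%R) -> (0 <= s < 1)%R ->
  ex_csum_from 1 u.
Proof.
  intros H Hs.
  apply (ex_series_le (V := C_CompleteNormedModule)
           (fun n => u (1 + n)%nat) (fun n => K * s ^ S n)%R).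
  - intros n. apply H; lia.
  - apply ex_series_ext with (fun n => (K * s) * s ^ n)%R.
    + intros n. simpl. ring.
    + apply (ex_series_scal_l (V := R_NormedModule) (K * s)%R (fun n => s ^ n)%R), ex_series_geom.
      rewrite Rabs_pos_eq; lra.
Qed.

Lemma tail_geom (u : nat -> C) (T : C) (K s : R) (m : nat) :
  (forall a, (1 <= a)%nat -> (Cmod (u a) <= K * s ^ a)%R) -> (0 <= s < 1)%R ->
  (0 <= K)%R -> is_csum_from 1 u T ->
  (Cmod (T - csum u m) <= K / (1 - s) * s ^ m)%R.
Proof.
  intros H Hs HK HT. apply is_csum_from_1_Cmod in HT.
  apply (is_lim_seq_incr_n _ m) in HT.
  (* The left side does not depend on n and the right side tends to 0, so the limit gives the tail
     bound. *)
  assert (Hle : forall n, (Cmod (T - csum u m) - K / (1 - s) * s ^ m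
                  <= Cmod (csum u (n + m) - T))%R).
  { intros n.
    assert (H1 := Cmod_csum_geom u K s m n H Hs).
    assert (H2 : (K * (s ^ S m - s ^ S (n + m)) <= K * s ^ m)%R).
    { apply Rmult_le_compat_l; [assumption|].
      assert (0 <= s ^ m)%R by (apply pow_le; lra).
      assert (0 <= s ^ S (n + m))%R by (apply pow_le; lra).
      change (s ^ S m)%R with (s * s ^ m)%R. nra. }
    assert (H3 : (Cmod (csum u (n + m) - csum u m) <= K / (1 - s) * s ^ m)%R).
    { apply Rmult_le_reg_r with (1 - s)%R; [lra|].
      replace (K / (1 - s) * s ^ m * (1 - s))%R with (K * s ^ m)%R
        by (field; lra). lra. }
    assert (H4 := Cmod_triangle (- (csum u (n + m) - T)) (csum u (n + m) - csum u m)).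
    rewrite Cmod_opp in H4.
    replace (- (csum u (n + m) - T) + (csum u (n + m) - csum u m))
      with (T - csum u m) in H4 by ring. lra. }
  assert (L := is_lim_seq_le _ _ _ _ Hle (is_lim_seq_const _) HT).
  simpl in L. lra.
Qed.

(** * Absorbing polynomial weights into geometric decay *)

(** Each of the n terms of 1 + s + ... + s^(n-1) = (1 - s^n) / (1 - s) is at least s^n. *)
Lemma INR_mul_pow_le (s : R) (n : nat) :
  (0 <= s < 1)%R -> (INR n * s ^ n * (1 - s) <= 1 - s ^ n)%R.
Proof.
  intros Hs. induction n as [|n IH]; [simpl; lra|].
  rewrite S_INR. simpl.
  assert (0 <= s ^ n)%R by (apply pow_le; lra).
  assert (s * (INR n * s ^ n * (1 - s)) <= s * (1 - s ^ n))%R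
    by (apply Rmult_le_compat_l; lra).
  assert (s ^ S n * (1 - s) <= 1 * (1 - s))%R.
  { apply Rmult_le_compat_r; [lra|]. rewrite <- (pow1 (S n)). apply pow_incr; lra. }
  simpl in *.
  lra.
Qed.

(** Serves twice: for the convergence of the series of [f1], and to make the error between the
    partial sums of [f1] and [f3] vanish. *)
Lemma INR2_mul_pow_le_geom (r : R) :
  (0 <= r < 1)%R ->
  exists K s : R, (0 <= K)%R /\ (0 <= s < 1)%R /\
    forall n : nat, (INR n * INR n * r ^ n <= K * s ^ n)%R.
Proof.
  intros Hr.
  (* With [s^4 = r], each factor [n] is absorbed by one factor [s^n]. *)
  set (s := sqrt (sqrt r)).
  assert (Hlt : forall t, (0 <= t < 1 -> 0 <= sqrt t < 1)%R).
  { intros t Ht; split; [apply sqrt_pos|].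
    rewrite <- sqrt_1. apply sqrt_lt_1; lra. }
  assert (Hs : (0 <= s < 1)%R) by (apply Hlt, Hlt, Hr).
  assert (E : r = (s * s * (s * s))%R).
  { unfold s. rewrite sqrt_sqrt by apply sqrt_pos. rewrite sqrt_sqrt; lra. }
  (* Each of the two factors n s^n is at most 1 / (1 - s); of the remaining s^(2n), one s^n is kept
     as the decay. *)
  exists (/ (1 - s) * / (1 - s))%R, s.
  assert (Hi : (0 < / (1 - s))%R) by (apply Rinv_0_lt_compat; lra).
  split; [nra | split; [exact Hs|]].
  intros n. rewrite E, !Rpow_mult_distr.
  assert (Hp : (0 <= s ^ n <= 1)%R).
  { split; [apply pow_le; lra|]. rewrite <- (pow1 n); apply pow_incr; lra. }
  assert (H1 : (INR n * s ^ n <= / (1 - s))%R).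
  { apply Rmult_le_reg_r with (1 - s)%R; [lra|].
    rewrite Rinv_l by lra. generalize (INR_mul_pow_le s n Hs). lra. }
  assert (H0 := pos_INR n).
  assert (H2 : (0 <= INR n * s ^ n)%R) by (apply Rmult_le_pos; lra).
  assert (H3 : ((INR n * s ^ n) * (INR n * s ^ n) <= / (1 - s) * / (1 - s))%R)
    by (apply Rmult_le_compat; lra).
  assert (H4 : (s ^ n * s ^ n <= s ^ n)%R) by nra.
  replace (INR n * INR n * (s ^ n * s ^ n * (s ^ n * s ^ n)))%R
    with ((INR n * s ^ n) * (INR n * s ^ n) * (s ^ n * s ^ n))%R by ring.
  apply Rmult_le_compat; nra.
Qed.

(** * Lambert terms and the two series expressed through them *)

(** Summed over k >= 1, this is the Lambert series generating the number of divisors. *)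
Definition lambert (q : C) (k : nat) : C := q ^ k / (1 - q ^ k).

(** Triangle inequality and |q|^k <= |q|; the bound keeps the denominators away from 0 uniformly in
    k. *)
Lemma Cmod_one_sub_pow (q : C) (k : nat) :
  (Cmod q < 1)%R -> (1 <= k)%nat -> (1 - Cmod q <= Cmod (1 - q ^ k))%R.
Proof.
  intros Hq Hk.
  assert (H0 := Cmod_ge_0 q).
  assert (H1 := Cmod_triangle (1 - q ^ k) (q ^ k)).
  replace (1 - q ^ k + q ^ k) with (RtoC 1) in H1 by ring.
  rewrite Cmod_1, Cmod_pow in H1.
  destruct k as [|k]; [lia|]. simpl in *.
  assert (Cmod q ^ k <= 1)%R by (rewrite <- (pow1 k); apply pow_incr; lra).
  nra.
Qed.

Lemma one_sub_pow_neq_0 (q : C) (k : nat) :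
  (Cmod q < 1)%R -> (1 <= k)%nat -> 1 - q ^ k <> 0.
Proof.
  intros Hq Hk. apply Cmod_gt_0.
  generalize (Cmod_one_sub_pow q k Hq Hk). lra.
Qed.

(** With A = q^a and B = q^b, divide 1 - AB = (1-A)(1-B) + A(1-B) + B(1-A) by (1-A)(1-B): the last
    factor equals (1 - AB) / ((1-A)(1-B)). *)
Lemma lambert_mul (q : C) (a b : nat) :
  (Cmod q < 1)%R -> (1 <= a)%nat -> (1 <= b)%nat ->
  lambert q a * lambert q b
  = lambert q (a + b) * (1 + lambert q a + lambert q b).
Proof.
  intros Hq Ha Hb. unfold lambert.
  assert (H1 := one_sub_pow_neq_0 q a Hq Ha).
  assert (H2 := one_sub_pow_neq_0 q b Hq Hb).
  assert (H3 := one_sub_pow_neq_0 q (a + b) Hq ltac:(lia)).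
  rewrite Cpow_add_r in *. field. auto.
Qed.

Lemma Cmod_lambert_le (q : C) (k : nat) :
  (Cmod q < 1)%R -> (1 <= k)%nat ->
  (Cmod (lambert q k) <= / (1 - Cmod q) * Cmod q ^ k)%R.
Proof.
  intros Hq Hk. unfold lambert.
  rewrite Cmod_div by (apply one_sub_pow_neq_0; assumption).
  unfold Rdiv. rewrite Cmod_pow, (Rmult_comm (Cmod q ^ k)).
  apply Rmult_le_compat_r; [apply pow_le, Cmod_ge_0|].
  apply Rinv_le_contravar; [lra|]. apply Cmod_one_sub_pow; assumption.
Qed.

Lemma f1_term_lambert (q : C) (n : nat) :
  (Cmod q < 1)%R -> (1 <= n)%nat ->
  f1_term q n = natC n * (natC n - 1) * lambert q n
                - 2 * natC n * (lambert q n * lambert q n).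
Proof.
  intros Hq Hn. unfold f1_term, lambert.
  assert (H := one_sub_pow_neq_0 q n Hq Hn).
  replace (2 * n)%nat with (n + n)%nat by lia.
  rewrite Cpow_add_r. field. auto.
Qed.

Lemma f3_term_lambert (q : C) (k l : nat) :
  (Cmod q < 1)%R -> (1 <= k)%nat -> (1 <= l)%nat ->
  f3_term q k l = 2 * natC k * lambert q k * lambert q l.
Proof.
  intros Hq Hk Hl. unfold f3_term, lambert.
  assert (H1 := one_sub_pow_neq_0 q k Hq Hk).
  assert (H2 := one_sub_pow_neq_0 q l Hq Hl).
  rewrite Cpow_add_r. field. auto.
Qed.

(** * Convergence of the series and equality of their sums *)

Lemma is_csum_f3_term (q T : C) (k : nat) :
  (Cmod q < 1)%R -> (1 <= k)%nat -> is_csum_from 1 (lambert q) T ->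
  is_csum_from (S k) (f3_term q k)
    (2 * natC k * lambert q k * (T - csum (lambert q) k)).
Proof.
  intros Hq Hk HT. apply is_csum_from_Cmod. apply is_csum_from_1_Cmod in HT.
  set (c := 2 * natC k * lambert q k).
  (* The factorization holds for every l >= 1, hence for sums from 1 although the series starts at
     k+1. *)
  assert (E : forall N, csum (f3_term q k) N = c * csum (lambert q) N).
  { intros N. rewrite <- csum_scal. apply csum_ext; intros a Ha.
    apply f3_term_lambert; auto; lia. }
  apply is_lim_seq_ext with (fun N => Cmod c * Cmod (csum (lambert q) N - T))%R.
  - intros N. rewrite <- Cmod_mult, !E. f_equal. ring.
  - replace (Finite 0) with (Rbar_mult (Cmod c) 0) by (simpl; f_equal; ring).
    apply is_lim_seq_scal_l, HT.
Qed.

Lemma ex_csum_f1_term (q : C) : (Cmod q < 1)%R -> ex_csum_from 1 (f1_term q).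
Proof.
  intros Hq. assert (H0 := Cmod_ge_0 q).
  destruct (INR2_mul_pow_le_geom (Cmod q) (conj H0 Hq)) as (K & s & HK & Hs & Hb).
  set (c := (/ (1 - Cmod q))%R).
  assert (Hc : (0 < c)%R) by (apply Rinv_0_lt_compat; lra).
  (* The two parts of the term are at most c n^2 |q|^n and 2 c^2 n^2 |q|^n, and n^2 |q|^n <= K
     s^n. *)
  apply ex_csum_geom with ((c + 2 * (c * c)) * K)%R s; [|exact Hs].
  intros n Hn. rewrite f1_term_lambert by assumption.
  assert (Hx := Cmod_lambert_le q n Hq Hn). fold c in Hx.
  assert (Hx0 := Cmod_ge_0 (lambert q n)).
  assert (Hn1 : (1 <= INR n)%R) by (apply (le_INR 1); assumption).
  assert (Hp : (0 <= Cmod q ^ n <= 1)%R).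
  { split; [apply pow_le; lra|]. rewrite <- (pow1 n); apply pow_incr; lra. }
  specialize (Hb n).
  set (p := (Cmod q ^ n)%R) in *. set (X := Cmod (lambert q n)) in *.
  eapply Rle_trans; [apply Cmod_triangle|].
  rewrite Cmod_opp, !Cmod_mult, Cmod_natC. fold X.
  replace (natC n - 1) with (RtoC (INR n - 1))
    by (unfold natC; rewrite RtoC_minus; reflexivity).
  rewrite !Cmod_R, !Rabs_pos_eq by lra.
  assert (H1 : (INR n * (INR n - 1) * X <= INR n * INR n * (c * p))%R)
    by (apply Rmult_le_compat; nra).
  assert (H2 : (X * X <= c * c * p)%R).
  { apply Rle_trans with ((c * p) * (c * p))%R; [apply Rmult_le_compat; lra|].
    replace (c * p * (c * p))%R with (c * c * (p * p))%R by ring.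
    apply Rmult_le_compat_l; nra. }
  assert (H3 : (2 * INR n * (X * X) <= 2 * (INR n * INR n) * (c * c * p))%R)
    by (apply Rmult_le_compat; nra).
  assert (H4 : ((c + 2 * (c * c)) * (INR n * INR n * p)
                <= (c + 2 * (c * c)) * (K * s ^ n))%R)
    by (apply Rmult_le_compat_l; nra).
  lra.
Qed.

(** Comparing partial sums yields the convergence of the outer series of [f3] together with its
    value. *)
Lemma is_csum_f3_inner (q s : C) :
  (Cmod q < 1)%R -> is_csum_from 1 (f1_term q) s ->
  is_csum_from 1 (f3_inner q) s.
Proof.
  intros Hq Hf. assert (H0 := Cmod_ge_0 q).
  set (c := (/ (1 - Cmod q))%R).
  assert (Hc : (0 < c)%R) by (apply Rinv_0_lt_compat; lra).
  assert (Hx : forall k, (1 <= k)%nat ->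
                 (Cmod (lambert q k) <= c * Cmod q ^ k)%R)
    by (intros k; apply Cmod_lambert_le, Hq).
  destruct (ex_csum_geom _ _ _ Hx (conj H0 Hq)) as [T HT].
  assert (Htail := fun m => tail_geom _ T c (Cmod q) m Hx (conj H0 Hq) ltac:(lra) HT).
  set (c' := (c / (1 - Cmod q))%R) in *.
  (* The inner sum carries T - S a, split as (T - S (N-a)) + (S (N-a) - S a); the second part
     reproduces the partial sum of [f1]. *)
  assert (Hdiff : forall N, csum (f3_inner q) N - csum (f1_term q) N
     = csum (fun a => 2 * natC a * lambert q a * (T - csum (lambert q) (N - a))) N).
  { intros N.
    replace (csum (f1_term q) N)
      with (csum (fun a => 2 * natC a * lambert q a *
              (csum (lambert q) (N - a) - csum (lambert q) a)) N).
    2: { rewrite <- truncated_identity by (intros; apply lambert_mul; assumption).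
         apply csum_ext; intros a Ha. symmetry; apply f1_term_lambert; [assumption|lia]. }
    rewrite (csum_ext (f3_inner q)
      (fun a => 2 * natC a * lambert q a * (T - csum (lambert q) (N - a))
              + 2 * natC a * lambert q a *
                  (csum (lambert q) (N - a) - csum (lambert q) a))).
    - rewrite csum_plus. ring.
    - intros a Ha. unfold f3_inner.
      rewrite (csum_from_unique _ _ _ (is_csum_f3_term q T a Hq ltac:(lia) HT)).
      ring. }
  assert (Hbound : forall N, (Cmod (csum (f3_inner q) N - csum (f1_term q) N)
     <= 2 * c * c' * (INR N * INR N * Cmod q ^ N))%R).
  { intros N. rewrite Hdiff.
    (* Each of the N summands has the same bound: the factors |q|^a from the Lambert term and
       |q|^(N-a) from the tail multiply to |q|^N. *)
    eapply Rle_trans;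
      [apply (Cmod_csum_le _ (2 * INR N * (c * c' * Cmod q ^ N))%R) | right; ring].
    intros a Ha. rewrite !Cmod_mult, Cmod_natC, Cmod_R, Rabs_pos_eq by lra.
    rewrite Rmult_assoc.
    assert (INR a <= INR N)%R by (apply le_INR; lia).
    assert (Ha0 := pos_INR a).
    assert (Hx0 := Cmod_ge_0 (lambert q a)).
    assert (Ht0 := Cmod_ge_0 (T - csum (lambert q) (N - a))).
    apply Rmult_le_compat; [lra | apply Rmult_le_pos; assumption | lra |].
    replace (c * c' * Cmod q ^ N)%R
      with ((c * Cmod q ^ a) * (c' * Cmod q ^ (N - a)))%R.
    - apply Rmult_le_compat; auto. apply Hx; lia.
    - replace N with (a + (N - a))%nat at 2 by lia. rewrite pow_add. ring. }
  destruct (INR2_mul_pow_le_geom (Cmod q) (conj H0 Hq)) as (K & t & HK & Ht & Hb).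
  assert (Hc' : (0 <= 2 * c * c')%R).
  { unfold c', Rdiv. fold c. nra. }
  apply is_csum_from_1_Cmod. apply is_csum_from_1_Cmod in Hf.
  apply is_lim_seq_0_le
    with (fun N => (2 * c * c' * K) * t ^ N + Cmod (csum (f1_term q) N - s))%R.
  - intros N. split; [apply Cmod_ge_0|].
    replace (csum (f3_inner q) N - s)
      with ((csum (f3_inner q) N - csum (f1_term q) N) + (csum (f1_term q) N - s))
      by ring.
    eapply Rle_trans; [apply Cmod_triangle|].
    apply Rplus_le_compat_r. eapply Rle_trans; [apply Hbound|].
    rewrite (Rmult_assoc (2 * c * c')).
    apply Rmult_le_compat_l; [exact Hc' | apply Hb].
  - replace (Finite 0) with (Finite (0 + 0)) by (f_equal; ring).
    apply is_lim_seq_plus'; [apply is_lim_seq_geom_scal, Ht | exact Hf].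
Qed.

(* The convergence clauses say that the series defining [f1 q] and [f3 q] have
   sums, so that the equality is one between genuine sums. *)
Theorem theorem3p4 :
  forall q : C, (Cmod q < 1)%R ->
    ex_csum_from 1 (f1_term q) /\
    (forall k : nat, (1 <= k)%nat -> ex_csum_from (S k) (f3_term q k)) /\
    ex_csum_from 1 (f3_inner q) /\
    f1 q = f3 q.
Proof.
  intros q Hq.
  destruct (ex_csum_f1_term q Hq) as [s Hs].
  assert (H3 := is_csum_f3_inner q s Hq Hs).
  destruct (ex_csum_geom (lambert q) (/ (1 - Cmod q)) (Cmod q)) as [T HT].
  { intros k; apply Cmod_lambert_le, Hq. }
  { split; [apply Cmod_ge_0 | exact Hq]. }
  split; [exists s; exact Hs|].
  split; [intros k Hk; eexists; exact (is_csum_f3_term q T k Hq Hk HT)|].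
  split; [exists s; exact H3|].
  unfold f1, f3.
  rewrite (csum_from_unique _ _ _ Hs), (csum_from_unique _ _ _ H3). reflexivity.
Qed.
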